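(* Let $K$ be a vertex-homogeneous finite simplicial complex. Then there exists $n\ge 1$ such that $K$ is isomorphic to the $n$-th multiple of its core.
   Context: All simplicial complexes are finite (simplices are nonempty finite sets of vertices). A complex $K$ is vertex-homogeneous if for any two vertices $v,w\in K$ there is a simplicial automorphism $\varphi:K\to K$ with $\varphi(v)=w$. For a vertex $v$ of a complex $K$, the link $\mathrm{lk}_K(v)$ is the subcomplex of simplices $\tau\in K$ with $v\notin\tau$ and $\tau\cup\{v\}\in K$, and $K\smallsetminus v$ is the full subcomplex of $K$ spanned by the vertices different from $v$. A simplicial cone is a complex $aM$, the join of a (possibly empty) complex $M$ and a vertex $a$ not in $M$; its simplices are $\{a\}$, the simplices $\tau$ of $M$, and the sets $\{a\}\cup\tau$ with $\tau\in M$. A vertex $v$ of $K$ is dominated if $\mathrm{lk}_K(v)$ is a simplicial cone; in that case there is an elementary strong collapse from $K$ to $K\smallsetminus v$. A strong collapse from $K$ to a subcomplex $L$ is a finite (possibly empty) sequence of elementary strong collapses starting in $K$ and ending in $L$. A complex is minimal if it has no dominated vertices. A core of $K$ is a subcomplex $K_0\subseteq K$ which is a minimal complex and such that $K$ strong collapses to $K_0$; every complex has a core and it is unique up to isomorphism, so one speaks of the core of $K$. For a complex $K$ with vertex set $V_K$ and $n\ge 1$, the $n$-th multiple $nK$ is the complex with vertex set $V_K\times\{1,2,\ldots,n\}$ whose simplices are the (nonempty) sets of vertices whose projections to $V_K$ are simplices of $K$. *)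

(* Defs.v *)
From HB Require Import structures.
From mathcomp Require Import all_boot.
From Stdlib Require Import Classical_Prop.

Set Implicit Arguments.
Unset Strict Implicit.
Unset Printing Implicit Defensive.

Definition is_complex (T : finType) (S : {set {set T}}) : bool :=
  (set0 \notin S) &&
  [forall s in S, forall t : {set T}, (t \subset s) && (t != set0) ==> (t \in S)].

(* The elements of [T] are only potential vertices: [x : T] is a vertex of [K]
   when [[set x] \in K].  This lets a complex and its subcomplexes share [T]. *)
Record complex (T : finType) := Complex {
  simplices :> {set {set T}};
  _ : is_complex simplices
}.

HB.instance Definition _ (T : finType) := [isSub for @simplices T].
HB.instance Definition _ (T : finType) := [Equality of complex T by <:].

Lemma is_complexP (T : finType) (S : {set {set T}}) :
  reflect (set0 \notin S /\
           forall s t : {set T}, s \in S -> t \subset s -> t != set0 -> t \in S)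
          (is_complex S).
Proof.
apply: (iffP andP) => [[S0 /forall_inP Sd]|[S0 Sd]]; split=> //.
  by move=> s t sS ts t0; have /forallP/(_ t)/implyP := Sd s sS; apply; rewrite ts.
apply/forall_inP => s sS; apply/forallP => t; apply/implyP => /andP[ts t0].
exact: Sd sS ts t0.
Qed.

Lemma complex_set0 (T : finType) (K : complex T) : set0 \notin K.
Proof. by case: K => S /= /is_complexP[]. Qed.

Lemma complex_sub (T : finType) (K : complex T) (s t : {set T}) :
  s \in K -> t \subset s -> t != set0 -> t \in K.
Proof. by case: K => S /= /is_complexP[_]; apply. Qed.

Definition vertices (T : finType) (K : complex T) : {set T} :=
  [set x | [set x] \in K].

Notation vertex K := {x : _ | x \in vertices K}.

Definition simplicial (T T' : finType) (K : complex T) (L : complex T')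
    (f : vertex K -> vertex L) : Prop :=
  forall s : {set vertex K}, val @: s \in K -> val @: (f @: s) \in L.

Definition isomorphism (T T' : finType) (K : complex T) (L : complex T')
    (f : vertex K -> vertex L) : Prop :=
  simplicial f /\
  exists g : vertex L -> vertex K, [/\ simplicial g, cancel f g & cancel g f].

Definition isomorphic (T T' : finType) (K : complex T) (L : complex T') : Prop :=
  exists f : vertex K -> vertex L, isomorphism f.

Definition vertex_homogeneous (T : finType) (K : complex T) : Prop :=
  forall v w : vertex K, exists f : vertex K -> vertex K, isomorphism f /\ f v = w.

Lemma link_subproof (T : finType) (K : complex T) (v : T) :
  is_complex [set t in K | (v \notin t) && (v |: t \in K)].
Proof.
apply/is_complexP; split; first by rewrite inE (negPf (complex_set0 K)).
move=> s t; rewrite !inE => /and3P[sK vs vsK] ts t0; apply/and3P; split.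
- exact: complex_sub sK ts t0.
- by apply: contra vs; apply: (subsetP ts).
- apply: (complex_sub vsK); first exact: setUS.
  by apply/set0Pn; exists v; rewrite setU11.
Qed.

Definition link (T : finType) (K : complex T) (v : T) : complex T :=
  Complex (link_subproof K v).

Lemma deletion_subproof (T : finType) (K : complex T) (v : T) :
  is_complex [set t in K | v \notin t].
Proof.
apply/is_complexP; split; first by rewrite inE (negPf (complex_set0 K)).
move=> s t; rewrite !inE => /andP[sK vs] ts t0; apply/andP; split.
- exact: complex_sub sK ts t0.
- by apply: contra vs; apply: (subsetP ts).
Qed.

Definition deletion (T : finType) (K : complex T) (v : T) : complex T :=
  Complex (deletion_subproof K v).

Lemma cone_subproof (T : finType) (a : T) (M : complex T) :
  is_complex ([set [set a]] :|: M :|: [set a |: t | t : {set T} in M]).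
Proof.
have aM0 (t : {set T}) : a |: t != set0 by apply/set0Pn; exists a; rewrite setU11.
apply/is_complexP; split.
  rewrite !inE (negPf (complex_set0 M)) orbF negb_or; apply/andP; split.
    by rewrite eq_sym; apply/set0Pn; exists a; rewrite set11.
  by apply/imsetP => -[t _ /esym/eqP]; rewrite (negPf (aM0 t)).
have key (s t : {set T}) : (s == set0) || (s \in M) -> t \subset a |: s -> t != set0 ->
    t \in [set [set a]] :|: M :|: [set a |: t | t : {set T} in M].
  move=> sM ts t0.
  have ts' : t :\ a \subset s by rewrite subDset.
  have tM : t :\ a != set0 -> t :\ a \in M.
    move=> ta0; case/orP: sM => [/eqP s0|sM]; last exact: complex_sub sM ts' ta0.
    by move: ta0; rewrite -subset0 -s0 ts'.
  case: (boolP (a \in t)) => at_.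
    have [ta0|/tM tM'] := eqVneq (t :\ a) set0.
      by rewrite -(setD1K at_) ta0 setU0 !inE eqxx.
    by rewrite inE; apply/orP; right; apply/imsetP; exists (t :\ a); rewrite ?setD1K.
  have E : t :\ a = t.
    by apply/setP=> x; rewrite !inE; case: eqP => //= ->; rewrite (negPf at_).
  by rewrite E in tM; rewrite !inE tM ?orbT.
move=> s t; rewrite in_setU => /orP[|/imsetP[r rM ->]] ts t0; last first.
  by apply: (key r) => //; rewrite rM orbT.
move: ts t0; rewrite in_setU in_set1 => /[swap] ts /[swap] t0 /orP[/eqP sa|sM].
  by apply: (key set0); rewrite ?eqxx // setU0 -sa.
by apply: (key s); rewrite ?sM ?orbT // (subset_trans ts) // subsetUr.
Qed.

Definition cone (T : finType) (a : T) (M : complex T) : complex T :=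
  Complex (cone_subproof a M).

Definition simplicial_cone (T : finType) (L : complex T) : Prop :=
  exists (a : T) (M : complex T), a \notin vertices M /\ L = cone a M.

Definition dominated (T : finType) (K : complex T) (v : T) : Prop :=
  v \in vertices K /\ simplicial_cone (link K v).

Inductive strong_collapse (T : finType) (K L : complex T) : Prop :=
| StrongCollapseRefl : K = L -> strong_collapse K L
| StrongCollapseStep (v : T) :
    dominated K v -> strong_collapse (deletion K v) L -> strong_collapse K L.

Definition minimal (T : finType) (K : complex T) : Prop :=
  forall v : T, ~ dominated K v.

Definition is_core (T : finType) (K0 K : complex T) : Prop :=
  [/\ K0 \subset K, minimal K0 & strong_collapse K K0].

Lemma multiple_subproof (T : finType) (n : nat) (K : complex T) :
  is_complex [set s : {set (T * 'I_n)%type} | fst @: s \in K].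
Proof.
apply/is_complexP; split; first by rewrite inE imset0 complex_set0.
move=> s t; rewrite !inE => sK ts t0; apply: (complex_sub sK); first exact: imsetS.
by rewrite imset_eq0.
Qed.

Definition multiple (T : finType) (n : nat) (K : complex T) : complex (T * 'I_n)%type :=
  Complex (multiple_subproof n K).

Lemma deletion_subset (T : finType) (K : complex T) (v : T) : deletion K v \subset K.
Proof. by apply/subsetP => s; rewrite inE => /andP[]. Qed.

(* Hence a statement about every core of [K] is never vacuous. *)
Lemma core_exists (T : finType) (K : complex T) : exists K0 : complex T, is_core K0 K.
Proof.
have [n] := ubnP #|K|; elim: n => // n IHn in K * => /ltnSE leKn.
have [[v domv]|nodom] := classic (exists v, dominated K v); last first.
  exists K; split=> //; last exact: StrongCollapseRefl.
  by move=> v domv; apply: nodom; exists v.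
have ltDK : #|deletion K v| < #|K|.
  apply/proper_card/properP; split; first exact: deletion_subset.
  have [vK _] := domv.
  by exists [set v]; [move: vK; rewrite inE | rewrite inE set11 andbF].
have [K0 [K0s K0m K0c]] := IHn _ (leq_trans ltDK leKn).
exists K0; split=> //; last exact: StrongCollapseStep domv K0c.
exact: subset_trans K0s (deletion_subset K v).
Qed.

(* Main.v *)
Require Import Defs.
From mathcomp Require Import all_boot.

(** Say that [v] is dominated by [w] when adding [w] to a simplex containing
    [v] always gives a simplex.  This is a preorder on the vertices, preserved
    by automorphisms.  In a vertex-homogeneous complex all up-sets have the same
    cardinality, and the up-set of [w] is contained in that of [v] whenever [v]
    is dominated by [w]; so the preorder is an equivalence relation, with
    classes of a common size [n].  Equivalent vertices are interchangeable in
    simplices.  An elementary strong collapse deletes a vertex equivalent to a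
    remaining one, so a core is the full subcomplex spanned by one vertex of
    each class, and [K] is its [n]-th multiple. *)

Set Implicit Arguments.
Unset Strict Implicit.
Unset Printing Implicit Defensive.

(** * Domination as a preorder on vertices *)

Definition dominated_by (T : finType) (K : complex T) (v w : T) : bool :=
  (v \in vertices K) && [forall s in K, (v \in s) ==> (w |: s \in K)].

Definition dominators (T : finType) (K : complex T) (v : T) : {set T} :=
  [set w | dominated_by K v w].

Lemma dominated_byP (T : finType) (K : complex T) (v w : T) :
  reflect (v \in vertices K /\
           forall s : {set T}, s \in K -> v \in s -> w |: s \in K)
          (dominated_by K v w).
Proof.
apply: (iffP andP) => -[vK H]; split=> //.
  by move=> s sK vs; have /forall_inP/(_ s sK)/implyP := H; apply.
by apply/forall_inP => s sK; apply/implyP; apply: H.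
Qed.

Section Complexes.

Variable T : finType.
Implicit Types (K L : complex T) (s t : {set T}) (v w x y : T).

Lemma simplex_neq0 K s : s \in K -> s != set0.
Proof. by move=> sK; apply: contraTneq sK => ->; apply: complex_set0. Qed.

Lemma simplex_vertex K s x : s \in K -> x \in s -> x \in vertices K.
Proof.
move=> sK xs; rewrite inE; apply: (complex_sub sK); first by rewrite sub1set.
by apply/set0Pn; exists x; rewrite set11.
Qed.

Lemma simplex_sub_vertices K s : s \in K -> s \subset vertices K.
Proof. by move=> sK; apply/subsetP => x; apply: simplex_vertex sK. Qed.

Lemma dominated_by_refl K v : v \in vertices K -> dominated_by K v v.
Proof.
by move=> vK; apply/dominated_byP; split=> // s sK vs; rewrite (setUidPr _) ?sub1set.
Qed.

Lemma dominated_by_vertex K v w : dominated_by K v w -> w \in vertices K.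
Proof.
case/dominated_byP => vK H; rewrite inE in vK.
by apply: (simplex_vertex (H _ vK (set11 v))); rewrite setU11.
Qed.

Lemma dominated_by_trans K u v w :
  dominated_by K u v -> dominated_by K v w -> dominated_by K u w.
Proof.
case/dominated_byP => uK uv /dominated_byP[_ vw].
apply/dominated_byP; split=> // s sK us.
apply: (complex_sub (vw _ (uv s sK us) (setU11 _ _))).
  by rewrite setUS // subsetUr.
by apply/set0Pn; exists w; rewrite setU11.
Qed.

(** The vertices of [t] are adjoined one at a time: [x] stays in the growing simplex, so its
    dominator [y] can always be added. *)
Lemma simplex_dominated K s t :
  s \in K -> (forall y, y \in t -> exists2 x, x \in s & dominated_by K x y) ->
  s :|: t \in K.
Proof.
move=> sK; rewrite -[t]set_enum.
elim: (enum t) => [|y l IHl] H.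
  by rewrite (_ : [set x in [::]] = set0) ?setU0 //; apply/setP => x; rewrite !inE.
have [|x xs /dominated_byP[_ xy]] := H y; first by rewrite !inE eqxx.
rewrite set_cons setUCA; apply: xy; last by rewrite inE xs.
by apply: IHl => z zl; apply: H; rewrite !inE in zl *; rewrite zl orbT.
Qed.

(** The apex of a cone structure on the link dominates [v]; conversely a dominating [w] is an apex,
    with base the link minus [w]. *)
Lemma dominatedP K v :
  dominated K v <-> exists2 w, w != v & dominated_by K v w.
Proof.
split=> [[vK [a [M [_ E]]]]|[w wv /dominated_byP[vK vw]]].
  have ElK t : (t \in link K v) = (t \in cone a M) by rewrite E.
  have := ElK [set a]; rewrite !inE eqxx /= => /and3P[_ va vaK].
  exists a; first by rewrite eq_sym.
  apply/dominated_byP; split=> // s sK vs.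
  (* The empty set is not a simplex, so the case where [s] is the singleton of [v] cannot go through
     the link. *)
  have [s0|s0] := eqVneq (s :\ v) set0.
    by rewrite -(setD1K vs) s0 setU0 setUC.
  have svM : s :\ v \in cone a M.
    rewrite -ElK inE setD1K // sK setD11 !andbT.
    by apply: complex_sub sK _ s0; apply: subD1set.
  have : a |: s :\ v \in cone a M.
    move: svM; rewrite 2!inE => /orP[/orP[/set1P ->|sM]|/imsetP[r rM ->]].
    - by rewrite setUid !inE eqxx.
    - by rewrite inE; apply/orP; right; apply: imset_f.
    - by rewrite setUA setUid inE; apply/orP; right; apply: imset_f.
  by rewrite -ElK inE => /and3P[_ _]; rewrite setUCA setD1K.
split=> //; exists w, (deletion (link K v) w); split.
  by rewrite !inE eqxx andbF.
have vwK : v |: [set w] \in K.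
  by rewrite setUC vw ?set11 //; rewrite inE in vK.
apply: val_inj; apply/setP => t; apply/idP/idP => [tL|].
  have [wt|wt] := boolP (w \in t); last first.
    by rewrite /= 2!in_setU; apply/orP; left; apply/orP; right; rewrite inE tL.
  have [t0|t0] := eqVneq (t :\ w) set0.
    by rewrite -(setD1K wt) t0 setU0 !inE eqxx.
  rewrite inE; apply/orP; right; apply/imsetP; exists (t :\ w); last by rewrite setD1K.
  rewrite inE setD11 andbT.
  by apply: complex_sub tL _ t0; apply: subD1set.
rewrite /= 2!in_setU => /orP[/orP[/set1P ->|]|/imsetP[r + ->]].
- rewrite !inE eq_sym wv vwK !andbT.
  have : w \in vertices K by apply: (simplex_vertex vwK); rewrite !inE eqxx orbT.
  by rewrite inE.
- by rewrite inE => /andP[].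
- rewrite inE => /andP[+ _]; rewrite !inE => /and3P[rK vr vrK].
  have wvrK : w |: (v |: r) \in K by rewrite vw ?setU11.
  rewrite negb_or eq_sym wv vr [v |: _]setUCA wvrK !andbT.
  apply: (complex_sub wvrK); first by rewrite setUS ?subsetUr.
  by apply/set0Pn; exists w; rewrite setU11.
Qed.

(** Invariant of strong collapses starting at [K]. When domination is symmetric, the second clause
    says that [L] meets every class. *)
Definition spanning_full K L : Prop :=
  (forall s, (s \in L) = (s \in K) && (s \subset vertices L)) /\
  (forall x, x \in vertices K -> exists2 y, y \in vertices L & dominated_by K x y).

Lemma spanning_full_refl K : spanning_full K K.
Proof.
split=> [s|x xK]; last by exists x => //; apply: dominated_by_refl.
by case: (boolP (s \in K)) => // /simplex_sub_vertices ->.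
Qed.

(** Serves to turn equivalence in [K] of two core vertices into domination inside the core, where
    minimality applies. *)
Lemma full_dominated_by K L v w :
  spanning_full K L -> v \in vertices L -> w \in vertices L ->
  dominated_by K v w -> dominated_by L v w.
Proof.
case=> full _ vL wL /dominated_byP[vK vw]; apply/dominated_byP; split=> // s.
rewrite !full => /andP[sK sL] vs.
by rewrite vw // subUset sub1set wL.
Qed.

Lemma vertices_deletion K v : vertices (deletion K v) = vertices K :\ v.
Proof. by apply/setP => x; rewrite !inE eq_sym andbC. Qed.

(** * Strong collapses when domination is symmetric *)

Section Symmetric.

Variable K : complex T.
Hypothesis symK : forall v w, dominated_by K v w -> dominated_by K w v.

(** A collapse of [L] refers to domination in [L]; this brings it back to the fixed preorder of [K].
    In general deletions can create new dominations; symmetry excludes this. *)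
Lemma spanning_dominated_by L v w :
  spanning_full K L -> dominated_by L v w -> dominated_by K v w.
Proof.
move=> [full span] /[dup] vw /dominated_byP[vL vwL].
have LK s : s \in L -> s \in K by rewrite full => /andP[].
have vK : v \in vertices K by move: vL; rewrite !inE; apply: LK.
apply/dominated_byP; split=> // s sK vs.
(* Push [s] into [L] along equivalent vertices, add [w], and come back. *)
pose s' := [set y in vertices L | [exists x in s, dominated_by K x y]].
have vs' : v \in s'.
  by rewrite inE vL; apply/exists_inP; exists v; rewrite ?dominated_by_refl.
have s'L : s' \in L.
  rewrite full; apply/andP; split; last by apply/subsetP => y; rewrite inE => /andP[].
  have H : s :|: s' \in K.
    by apply: simplex_dominated => // y; rewrite inE => /andP[_ /exists_inP].
  apply: (complex_sub H); first exact: subsetUr.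
  by apply/set0Pn; exists v.
have {}vwK := LK _ (vwL _ s'L vs').
have H : w |: s' :|: s \in K.
  apply: simplex_dominated => // x xs.
  have [y yL xy] := span x (simplex_vertex sK xs).
  exists y; last exact: symK.
  by rewrite in_setU1 inE yL; apply/orP; right; apply/exists_inP; exists x.
apply: (complex_sub H); first by rewrite setUAC subsetUl.
by apply/set0Pn; exists w; rewrite setU11.
Qed.

Lemma spanning_deletion L v :
  spanning_full K L -> dominated L v -> spanning_full K (deletion L v).
Proof.
move=> KL /dominatedP[w wv vw].
have vwK := spanning_dominated_by KL vw.
have [full span] := KL; rewrite /spanning_full vertices_deletion; split=> [s|x xK].
  by rewrite inE full subsetD1 andbA.
have [y yL xy] := span x xK.
(* If the chosen dominator of [x] is the deleted [v], then [w] takes over. *)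
have [yv|yv] := eqVneq y v; last by exists y; rewrite // in_setD1 yv.
exists w; first by rewrite in_setD1 wv (dominated_by_vertex vw).
by apply: dominated_by_trans vwK; rewrite -yv.
Qed.

Lemma spanning_collapse L L0 :
  strong_collapse L L0 -> spanning_full K L -> spanning_full K L0.
Proof.
by elim=> {L L0} [L L0 -> //|L L0 v domv _ IH KL]; apply: IH; apply: spanning_deletion.
Qed.

End Symmetric.

End Complexes.

(** * Isomorphisms and domination *)

Lemma isomorphic_on_vertices (T T' : finType) (K : complex T) (L : complex T')
    (F : T -> T') (G : T' -> T) :
  (forall s : {set T}, s \in K -> F @: s \in L) ->
  (forall s : {set T'}, s \in L -> G @: s \in K) ->
  {in vertices K, cancel F G} -> {in vertices L, cancel G F} -> isomorphic K L.
Proof.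
move=> FKL GLK FG GF.
have FV (x : vertex K) : F (val x) \in vertices L.
  by case: x => x /=; rewrite !inE -imset_set1; apply: FKL.
have GV (y : vertex L) : G (val y) \in vertices K.
  by case: y => y /=; rewrite !inE -imset_set1; apply: GLK.
pose f (x : vertex K) : vertex L := Sub (F (val x)) (FV x).
pose g (y : vertex L) : vertex K := Sub (G (val y)) (GV y).
exists f; split=> [s sK|].
  by rewrite -imset_comp (eq_imset (g := F \o val)) // imset_comp FKL.
exists g; split=> [s sL|x|y].
- by rewrite -imset_comp (eq_imset (g := G \o val)) // imset_comp GLK.
- by apply: val_inj; rewrite /= FG //; apply: (valP x).
- by apply: val_inj; rewrite /= GF //; apply: (valP y).
Qed.

(** Pull a simplex containing [f x] back by the inverse, add [y], and push forward by [f]. *)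
Lemma isomorphism_dominated_by (T : finType) (K : complex T)
    (f : vertex K -> vertex K) (x y : vertex K) :
  isomorphism f -> dominated_by K (val x) (val y) ->
  dominated_by K (val (f x)) (val (f y)).
Proof.
move=> [sf [g [sg fg gf]]] /dominated_byP[xK xy].
apply/dominated_byP; split=> [|s sK fxs]; first exact: valP.
pose s' : {set vertex K} := [set z | val z \in s].
have Es : val @: s' = s.
  apply/setP => z; apply/imsetP/idP => [[u + ->]|zs]; first by rewrite inE.
  by exists (Sub z (simplex_vertex sK zs)); rewrite ?inE.
have gsK : val @: (g @: s') \in K by apply: sg; rewrite Es.
have xgs : val x \in val @: (g @: s').
  by apply: imset_f; rewrite -[x]fg; apply: imset_f; rewrite inE.
have := xy _ gsK xgs; rewrite -imset_set1 -imsetU => /sf.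
rewrite !imsetU !imset_set1 -[f @: (g @: s')]imset_comp.
by rewrite (eq_imset (g := id)) // imset_id Es.
Qed.

(** * Symmetry of domination in the vertex-homogeneous case *)

Section Homogeneous.

Variables (T : finType) (K : complex T).
Hypothesis homK : vertex_homogeneous K.
Implicit Types (v w x y : T).

(** An automorphism taking [v] to [w] maps the up-set of [v] injectively into that of [w]. *)
Lemma leq_card_dominators v w :
  v \in vertices K -> w \in vertices K -> #|dominators K v| <= #|dominators K w|.
Proof.
move=> vK wK; have [f [isof fv]] := homK (Sub v vK) (Sub w wK).
pose D (x : vertex K) : {set vertex K} := [set y | dominated_by K (val x) (val y)].
have cardD (x : vertex K) : #|dominators K (val x)| = #|D x|.
  rewrite -(card_imset _ val_inj); apply: eq_card => y; rewrite inE.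
  apply/idP/imsetP => [xy|[z + ->]]; last by rewrite inE.
  by exists (Sub y (dominated_by_vertex xy)); rewrite ?inE.
have injf : injective f by have [_ [g [_ fg _]]] := isof; apply: can_inj fg.
rewrite (cardD (Sub v vK)) (cardD (Sub w wK)) -(card_imset _ injf) -fv.
apply: subset_leq_card; apply/subsetP => _ /imsetP[y + ->].
by rewrite !inE; apply: isomorphism_dominated_by.
Qed.

(** Nested up-sets of equal cardinality coincide, and [v] lies in its own. *)
Lemma homogeneous_dominated_by_sym v w :
  dominated_by K v w -> dominated_by K w v.
Proof.
move=> vw; have /andP[vK _] := vw; have wK := dominated_by_vertex vw.
have sub : dominators K w \subset dominators K v.
  by apply/subsetP => x; rewrite !inE; apply: dominated_by_trans.
have : dominators K w == dominators K v by rewrite eqEcard sub leq_card_dominators.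
by move/eqP/setP/(_ v); rewrite !inE dominated_by_refl.
Qed.

End Homogeneous.

(** * The multiple of a transversal of the classes *)

Lemma isomorphic_multiple_transversal (T : finType) (K K0 : complex T) (m : nat) :
  (forall v w, dominated_by K v w -> dominated_by K w v) ->
  {in vertices K, forall v, #|dominators K v| = m.+1} ->
  spanning_full K K0 ->
  {in vertices K0 &, forall x y, dominated_by K x y -> x = y} ->
  isomorphic K (multiple m.+1 K0).
Proof.
move=> symK cardK [full span] transK0.
(* The representative of [x] in [K0]; the default is never reached on vertices of [K]. *)
pose rep x := odflt x [pick y in vertices K0 | dominated_by K x y].
have repP x : x \in vertices K -> rep x \in vertices K0 /\ dominated_by K x (rep x).
  move=> /span[y yK0 xy]; rewrite /rep; case: pickP => [z /andP[]//|/(_ y)].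
  by rewrite yK0 xy.
have K0K x : x \in vertices K0 -> x \in vertices K.
  by rewrite !inE full => /andP[].
(* The second coordinate is the position of [x] in its class, which has [m.+1] elements, so [inord]
   does not truncate it. *)
pose F x : T * 'I_m.+1 := (rep x, inord (index x (enum (dominators K (rep x))))).
pose G (p : T * 'I_m.+1) := nth p.1 (enum (dominators K p.1)) p.2.
have GP p : p.1 \in vertices K -> dominated_by K p.1 (G p).
  move=> pK; have : G p \in enum (dominators K p.1).
    by apply: mem_nth; rewrite -cardE cardK.
  by rewrite mem_enum inE.
have V_multiple p : p \in vertices (multiple m.+1 K0) -> p.1 \in vertices K0.
  by rewrite !inE imset_set1.
apply: (@isomorphic_on_vertices _ _ _ _ F G) => [s sK|s|x xK|p pV].
- have Erep : fst @: (F @: s) = rep @: s by rewrite -imset_comp; apply: eq_imset.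
  rewrite inE Erep full; apply/andP; split; last first.
    apply/subsetP => _ /imsetP[x xs ->].
    by have [] := repP x (simplex_vertex sK xs).
  (* Adjoin the representatives to [s], then keep only them. *)
  have H : s :|: rep @: s \in K.
    apply: simplex_dominated => // _ /imsetP[x xs ->].
    by exists x => //; have [] := repP x (simplex_vertex sK xs).
  by apply: (complex_sub H); rewrite ?subsetUr // imset_eq0 (simplex_neq0 sK).
- rewrite inE => sK0.
  have /andP[sK sV] : (fst @: s \in K) && (fst @: s \subset vertices K0) by rewrite -full.
  have H : fst @: s :|: G @: s \in K.
    apply: simplex_dominated => // _ /imsetP[p ps ->].
    exists p.1; first exact: imset_f.
    by apply/GP/K0K; apply: (subsetP sV); apply: imset_f.
  apply: (complex_sub H); first exact: subsetUr.
  by have := simplex_neq0 sK; rewrite !imset_eq0.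
- have [rK0 xr] := repP x xK.
  have xD : x \in enum (dominators K (rep x)) by rewrite mem_enum inE symK.
  rewrite /G /F /= inordK ?nth_index //.
  by rewrite -(cardK (rep x)) ?K0K // cardE index_mem.
- have p1 := V_multiple p pV.
  have pG := GP p (K0K _ p1).
  (* Both sides are vertices of [K0] in the same class. *)
  have Er : rep (G p) = p.1.
    have [rK0 Gr] := repP (G p) (dominated_by_vertex pG).
    by apply/esym/transK0 => //; apply: dominated_by_trans Gr.
  rewrite /F Er /G index_uniq ?enum_uniq //; last by rewrite -cardE cardK // K0K.
  by rewrite inord_val -surjective_pairing.
Qed.

Theorem proposition6p9 (T : finType) (K : complex T) (hK : vertex_homogeneous K) :
  exists n : nat, 1 <= n /\
    forall K0 : complex T, is_core K0 K -> isomorphic K (multiple n K0).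
Proof.
have symK := homogeneous_dominated_by_sym hK.
(* The multiplicity is the common class size, fixed before the core is chosen; without vertices any
   [m] works. *)
have [m cardK] : exists m, {in vertices K, forall v, #|dominators K v| = m.+1}.
  have [K0|[x xK]] := set_0Vmem (vertices K).
    by exists 0 => v; rewrite K0 inE.
  exists #|dominators K x|.-1 => v vK.
  rewrite prednK; last by apply/card_gt0P; exists x; rewrite inE dominated_by_refl.
  by apply/eqP; rewrite eqn_leq !leq_card_dominators.
exists m.+1; split=> // K0 [_ minK0 colK0].
have spanK0 := spanning_collapse symK colK0 (spanning_full_refl K).
apply: isomorphic_multiple_transversal => // x y xK0 yK0 xy.
(* Two distinct equivalent vertices of [K0] would make [x] dominated in [K0]. *)
apply/eqP; rewrite eq_sym; apply/negP => /negP yx.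
apply: (minK0 x); apply/dominatedP; exists y => //.
exact: full_dominated_by spanK0 xK0 yK0 xy.
Qed.
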